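(* Let $v$ be a weight with $v(t)\le1$ for all $t\ge0$ (for example, a normalized weight). Then both classes $H^{\infty}_{\underline{\mathcal V}^{\mathfrak c}}$ and $H^{\infty}_{\overline{\mathcal V}^{\mathfrak c}}$ are closed under point-wise multiplication $\mathfrak m:(f,g)\mapsto f\cdot g$, and the bilinear maps $$\mathfrak m:H^{\infty}_{\underline{\mathcal V}^{\mathfrak c}}\times H^{\infty}_{\underline{\mathcal V}^{\mathfrak c}}\to H^{\infty}_{\underline{\mathcal V}^{\mathfrak c}},\qquad \mathfrak m:H^{\infty}_{\overline{\mathcal V}^{\mathfrak c}}\times H^{\infty}_{\overline{\mathcal V}^{\mathfrak c}}\to H^{\infty}_{\overline{\mathcal V}^{\mathfrak c}}$$ are continuous.
   Context: $\mathbb{N}_{>0}=\{1,2,\dots\}$. A weight is a continuous, non-increasing function $v:[0,+\infty)\to(0,+\infty)$ with $\lim_{t\to+\infty}t^kv(t)=0$ for all $k\ge0$; it is normalized if $v(t)=1$ for $t\in[0,1]$. $H(\mathbb{C})$ is the space of entire functions and $H^{\infty}_v:=\{f\in H(\mathbb{C}):\|f\|_v:=\sup_{z\in\mathbb{C}}|f(z)|v(|z|)<+\infty\}$, a Banach space with norm $\|\cdot\|_v$. For $c>0$ let $v^c(t):=v(t)^c$, and (when $v\le1$) put $\underline{\mathcal V}^{\mathfrak c}:=(v^c)_{c\in\mathbb{N}_{>0}}$, $\overline{\mathcal V}^{\mathfrak c}:=(v^{1/c})_{c\in\mathbb{N}_{>0}}$. $H^{\infty}_{\underline{\mathcal V}^{\mathfrak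 c}}:=\varinjlim_{c\to\infty}H^{\infty}_{v^c}$ is the locally convex inductive limit (an (LB)-space; as a set the union), and $H^{\infty}_{\overline{\mathcal V}^{\mathfrak c}}:=\varprojlim_{c\to\infty}H^{\infty}_{v^{1/c}}$ is the projective limit (a Fréchet space; as a set the intersection). *)

(* Defs.v *)
From HB Require Import structures.
From mathcomp Require Import all_boot all_order all_algebra.
From mathcomp Require Import all_classical all_reals all_analysis.
From mathcomp Require Import complex.

Set Implicit Arguments.
Unset Strict Implicit.
Unset Printing Implicit Defensive.

Import Order.TTheory GRing.Theory Num.Theory.
Import numFieldNormedType.Exports numFieldTopology.Exports.
Import ComplexField.Normc.

Local Open Scope classical_set_scope.
Local Open Scope ring_scope.
Local Open Scope complex_scope.

Lemma convex_setP (K : numDomainType) (E : lmodType K) (W : set E) : convex_set W <->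
  (forall x y (t : K), 0 <= t -> t <= 1 -> W x -> W y ->
    W (t *: x + (1 - t) *: y)).
Proof.
split=> [cW x y t t0 t1 Wx Wy|cW x y l]; last first.
  rewrite !inE => Wx Wy.
  by apply: cW.
by have := cW x y (Itv01 t0 t1); rewrite !inE; apply.
Qed.

Section LocallyConvexInductiveLimit.
Context (K : numFieldType) (E : lmodType K) (X : nat -> tvsType K)
  (i : forall n, {linear X n -> E}).

(* Locally convex inductive limit of the [X n] along the [i n]: the topology on
   [E] having as base of neighbourhoods of 0 the absolutely convex absorbing
   sets whose preimage under every [i n] is a neighbourhood of 0. It is the
   finest locally convex topology making all [i n] continuous, see
   [indlim_incl_continuous] and [indlim_universal]. *)
Definition indlim (_ : forall n, {linear X n -> E}) : Type := E.

Definition balanced (W : set E) :=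
  forall (a : K) x, `|a| <= 1 -> W x -> W (a *: x).

Definition absorbing (W : set E) :=
  forall x, \forall a \near (0 : K^o), W (a *: x).

Definition indlim_base (W : set E) :=
  [/\ convex_set W, balanced W, absorbing W &
      forall n, nbhs (0 : X n) (i n @^-1` W)].

Definition indlim_nbhs (x : E) : set_system E :=
  [set U | exists2 W, indlim_base W & forall y, W y -> U (x + y)].

Lemma indlim_baseT : indlim_base setT.
Proof.
split.
- by apply/convex_setP.
- by [].
- by move=> x; exact: filterT.
- by move=> n; exact: filterT.
Qed.

Lemma indlim_baseI W1 W2 :
  indlim_base W1 -> indlim_base W2 -> indlim_base (W1 `&` W2).
Proof.
move=> [/convex_setP c1 b1 a1 n1] [/convex_setP c2 b2 a2 n2]; split.
- apply/convex_setP=> x y t t0 t1 [? ?] [? ?]; split; [exact: c1|exact: c2].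
- by move=> a x al [? ?]; split; [exact: b1|exact: b2].
- by move=> x; apply: filterI; [exact: a1|exact: a2].
- by move=> n; apply: filterI; [exact: n1|exact: n2].
Qed.

Lemma indlim_baseZ W (c : K) :
  c != 0 -> indlim_base W -> indlim_base [set x | W (c *: x)].
Proof.
move=> c0 [/convex_setP cW bW aW nW]; split.
- apply/convex_setP=> x y t t0 t1 /= Wx Wy.
  by rewrite scalerDr !scalerA mulrC (mulrC c) -!scalerA; exact: cW.
- move=> a x a1 /= Wx.
  by rewrite scalerA mulrC -scalerA; exact: bW.
- move=> x /=; have := aW (c *: x); apply: filterS => a.
  by rewrite !scalerA mulrC.
- move=> n; have := @nbhs0Z _ (X n) _ c^-1 _ (nW n).
  rewrite invr_eq0 => /(_ c0); apply: filterS => x [y Wy <-] /=.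
  by rewrite linearZ scalerA divff// scale1r.
Qed.

Lemma indlim_base0 W : indlim_base W -> W 0.
Proof. by case=> _ _ /(_ 0) /nbhs_singleton; rewrite scaler0. Qed.

Lemma indlim_baseD W x y :
  indlim_base W -> W (2 *: x) -> W (2 *: y) -> W (x + y).
Proof.
move=> [/convex_setP cW _ _ _] Wx Wy.
have := cW _ _ (2^-1) _ _ Wx Wy; rewrite invr_ge0 ler0n => /(_ erefl).
rewrite invf_le1 ?ltr0n// ler1n => /(_ erefl).
have -> : 1 - 2^-1 = 2^-1 :> K by rewrite {1}(splitr 1) div1r addrK.
by rewrite !scalerA mulVf ?scale1r// pnatr_eq0.
Qed.

Lemma indlim_nbhs_filter x : ProperFilter (indlim_nbhs x).
Proof.
apply: Build_ProperFilter_ex.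
  by move=> A [W bW WA]; exists (x + 0); apply: WA; exact: indlim_base0.
split.
- by exists setT; [exact: indlim_baseT|].
- move=> A B [W1 b1 h1] [W2 b2 h2]; exists (W1 `&` W2).
    exact: indlim_baseI.
  by move=> y [? ?]; split; [exact: h1|exact: h2].
- by move=> A B AB [W bW h]; exists W => // y /h /AB.
Qed.

Lemma indlim_nbhs_singleton x U : indlim_nbhs x U -> U x.
Proof. by move=> [W bW h]; rewrite -(addr0 x); apply: h; exact: indlim_base0. Qed.

Lemma indlim_nbhs_nbhs x U :
  indlim_nbhs x U -> indlim_nbhs x (indlim_nbhs^~ U).
Proof.
move=> [W bW h]; have two0 : (2 : K) != 0 by rewrite pnatr_eq0.
exists [set x | W (2 *: x)]; first exact: indlim_baseZ.
move=> y /= Wy; exists [set x | W (2 *: x)]; first exact: indlim_baseZ.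
by move=> z /= Wz; rewrite -addrA; apply: h; exact: indlim_baseD.
Qed.

Local Notation L := (indlim i).

HB.instance Definition _ := GRing.Lmodule.on L.
HB.instance Definition _ := hasNbhs.Build L indlim_nbhs.
HB.instance Definition _ := Nbhs_isNbhsTopological.Build L
  indlim_nbhs_filter indlim_nbhs_singleton indlim_nbhs_nbhs.

Lemma indlim_add_continuous : continuous (fun x : L * L => x.1 + x.2).
Proof.
move=> [x y] U /= [W bW h]; have two0 : (2 : K) != 0 by rewrite pnatr_eq0.
pose W2 := [set x | W (2 *: x)].
have bW2 : indlim_base W2 by exact: indlim_baseZ.
exists ([set x + z | z in W2], [set y + z | z in W2]).
  by split; exists W2 => //= z Wz; exists z.
move=> [_ _] /= [[a Wa <-] [b Wb <-]] /=.
by rewrite addrACA; apply: h; exact: indlim_baseD.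
Qed.

Lemma indlim_scale_continuous : continuous (fun z : K^o * L => z.1 *: z.2).
Proof.
move=> [r x] U /= [W bW h]; have two0 : (2 : K) != 0 by rewrite pnatr_eq0.
pose M := `|r| + 1; have M0 : 0 < M by rewrite ltr_wpDl.
pose W2 := [set x | W (2 *: x)].
have bW2 : indlim_base W2 by exact: indlim_baseZ.
have [_ blW2 aW2 _] := bW2.
have bW3 : indlim_base [set x | W2 (M *: x)].
  by apply: indlim_baseZ => //; rewrite gt_eqF.
exists ([set s | `|r - s| < 1 /\ W2 ((s - r) *: x)],
        [set x + z | z in [set x | W2 (M *: x)]]).
  split; last by exists [set x | W2 (M *: x)] => //= z Wz; exists z.
  apply: filterI; first by exists 1 => //=.
  have /nbhs_ballP[e e0 he] := aW2 x.
  exists e => //= s; rewrite /= distrC => rs; apply: he.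
  by rewrite -ball_normE /= sub0r normrN.
move=> [s _] /= [[rs Ws] [z Wz <-]] /=.
rewrite scalerDr (_ : s *: x = r *: x + (s - r) *: x); last first.
  by rewrite scalerBl addrC subrK.
rewrite -addrA; apply: h; apply: indlim_baseD => //.
have -> : s *: z = (s / M) *: (M *: z) by rewrite scalerA divfK ?gt_eqF.
apply: blW2 => //; rewrite normrM normfV (gtr0_norm M0) ler_pdivrMr// mul1r.
rewrite -(subrK r s) (le_trans (ler_normD _ _))// addrC lerD2l distrC.
exact: ltW.
Qed.

Lemma indlim_locally_convex : exists2 B : set_system L,
  (forall b, b \in B -> convex_set b) & basis B.
Proof.
exists [set b | open b /\ convex_set b]; first by move=> b /[!inE] -[].
split; first by move=> b [].
move=> x U /= [W bW h]; have [/convex_setP cW _ _ _] := bW.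
pose V := [set y | W (y - x)].
have nV : nbhs (x : L) V.
  by exists W => // y Wy; rewrite /V /= addrAC subrr add0r.
exists (V° : set L) => /=; last first.
  by move=> y /nbhs_singleton /h; rewrite addrC subrK.
split; last exact: nV.
split; first exact: open_interior.
apply/convex_setP => y z t t0 t1 [W1 b1 h1] [W2 b2 h2].
exists (W1 `&` W2); first exact: indlim_baseI.
move=> u [W1u W2u]; rewrite /V /=.
have -> : t *: y + (1 - t) *: z + u - x
    = t *: (y + u - x) + (1 - t) *: (z + u - x).
  rewrite -!addrA; move: (u - x) => w; rewrite !scalerDr addrACA -scalerDl.
  by rewrite [t + _]addrC subrK scale1r addrA.
by apply: cW => //; [exact: h1|exact: h2].
Qed.

HB.instance Definition _ := PreTopologicalLmod_isTvs.Build K L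
  indlim_add_continuous indlim_scale_continuous indlim_locally_convex.
(* The factory [PreTopologicalLmod_isTvs] only provides the uniform structure. *)
HB.instance Definition _ := PreTopologicalNmodule_isTopologicalNmodule.Build
  L indlim_add_continuous.
HB.instance Definition _ := TopologicalNmodule_isTopologicalLmodule.Build
  K L indlim_scale_continuous.
HB.instance Definition _ := Uniform_isTvs.Build K L indlim_locally_convex.

Lemma indlim_incl_continuous n : continuous (i n : X n -> L).
Proof.
move=> x U /= [W [_ _ _ nW] h].
have := nbhsT x (nW n); apply: filterS => _ [y Wy <-].
by rewrite /= linearD; exact: h.
Qed.

Lemma indlim_universal (F : tvsType K) (f : {linear E -> F}) :
  (forall n, continuous (fun x : X n => f (i n x))) ->
  continuous (f : L -> F).
Proof.
move=> fi x U nU.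
have n0 : nbhs (0 : F) [set y | U (f x + y)].
  have := @add_continuous F (f x, 0); rewrite /continuous_at /= addr0.
  move=> /(_ U nU) [[P Q] /= [nP nQ] PQ].
  apply: filterS nQ => y Qy /=.
  by apply: (PQ (f x, y)); split=> //=; exact: nbhs_singleton nP.
have [B cB [oB bB]] := @locally_convex K F.
have [V /= [BV V0] VU] := bB 0 _ n0.
have nV : nbhs (0 : F) V by apply: open_nbhs_nbhs; split => //; exact: oB.
have /convex_setP cV : convex_set V by apply: cB; rewrite inE.
pose V0' := [set y : F | forall a : K, `|a| <= 1 -> V (a *: y)].
have nV0 : nbhs (0 : F) V0'.
  have := @scale_continuous K F (0, 0); rewrite /continuous_at /= scale0r.
  move=> /(_ V nV) [[P Q] /= [/nbhs_ballP[d /= d0 dP] nQ] PQ].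
  have d20 : d / 2 != 0 by rewrite mulf_neq0// ?invr_eq0 ?pnatr_eq0// gt_eqF.
  have := nbhs0Z d20 nQ; apply: filterS => _ [y Qy <-] a a1.
  rewrite scalerA; apply: (PQ (a * (d / 2), y)); split => //=.
  apply: dP; rewrite -ball_normE /= sub0r normrN normrM.
  rewrite (le_lt_trans (ler_piMl _ a1))// gtr0_norm ?divr_gt0//.
  by rewrite ltr_pdivrMr// ltr_pMr// ltr1n.
exists (f @^-1` V0').
  split.
  - apply/convex_setP => y z t t0 t1 Vy Vz a a1 /=.
    rewrite linearD !linearZ /= scalerDr !scalerA mulrC (mulrC a) -!scalerA.
    by apply: cV => //; [exact: Vy|exact: Vz].
  - move=> a y a1 Vy b b1 /=; rewrite linearZ /= scalerA.
    by apply: Vy; rewrite normrM mulr_ile1.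
  - move=> y; have := @scale_continuous K F (0, f y).
    rewrite /continuous_at /= scale0r => /(_ _ nV0) [[P Q] /= [nP nQ] PQ].
    apply: filterS nP => a Pa /=; rewrite linearZ /=.
    by apply: (PQ (a, f y)); split => //=; exact: nbhs_singleton nQ.
  - by move=> n; apply: (fi n 0); rewrite /= !linear0.
by move=> y Vy; rewrite /= linearD; apply: VU; rewrite -(scale1r (f y));
  apply: Vy; rewrite normr1.
Qed.

End LocallyConvexInductiveLimit.

Section ProjectiveLimit.
Context (K : numFieldType) (E : lmodType K) (X : nat -> tvsType K)
  (p : forall n, {linear E -> X n}).

(* Projective limit: [E] with the coarsest topology making all [p n]
   continuous. *)
Definition projlim (_ : forall n, {linear E -> X n}) : Type := E.

Local Notation P := (projlim p).

HB.instance Definition _ := GRing.Lmodule.on P.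
HB.instance Definition _ := Topological.copy P
  (sup_topology (fun n => Topological.class (initial_topology (p n)))).

Lemma projlim_cvg (T : Type) (F : set_system T) (f : T -> P) (x : P) :
  Filter F -> f @ F --> x <-> forall n, (fun t => p n (f t)) @ F --> p n x.
Proof.
move=> FF; split=> [fx n|fx].
  have /cvg_sup /(_ n) h := fx.
  apply: (cvg_comp f (p n : initial_topology (p n) -> X n) h).
  exact: initial_continuous.
apply/cvg_sup => n U /= [_ [[A oA <-] Ax] AU].
have nA : nbhs (p n x) A by exact: open_nbhs_nbhs.
have /= FA := fx n A nA.
by apply: (@filterS _ F _ _ _ _ FA) => t At; exact: AU.
Qed.

Lemma projlim_proj_continuous n : continuous (p n : P -> X n).
Proof. by move=> x; have /projlim_cvg := @cvg_id _ (nbhs (x : P)); apply. Qed.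

Lemma projlim_add_continuous : continuous (fun x : P * P => x.1 + x.2).
Proof.
move=> [x y]; apply/projlim_cvg => n /=.
under eq_fun do rewrite linearD.
rewrite linearD; apply: (cvg_comp2 (h := +%R) _ _ (@add_continuous (X n) (p n x, p n y))).
- by apply: (cvg_comp fst (p n)); [exact: cvg_fst|exact: projlim_proj_continuous].
- by apply: (cvg_comp snd (p n)); [exact: cvg_snd|exact: projlim_proj_continuous].
Qed.

Lemma projlim_scale_continuous : continuous (fun z : K^o * P => z.1 *: z.2).
Proof.
move=> [r x]; apply/projlim_cvg => n /=.
under eq_fun do rewrite linearZ.
rewrite linearZ /=.
apply: (cvg_comp2 (h := *:%R) _ _ (@scale_continuous K (X n) (r, p n x))).
- exact: cvg_fst.
- by apply: (cvg_comp snd (p n)); [exact: cvg_snd|exact: projlim_proj_continuous].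
Qed.

Lemma projlim_locally_convex : exists2 B : set_system P,
  (forall b, b \in B -> convex_set b) & basis B.
Proof.
pose B := [set b : set P | open b /\ convex_set b].
exists B; first by move=> b /[!inE] -[].
split; first by move=> b [].
move=> x; pose F : set_system P := filter_from [set b | B b /\ b x] id.
have FF : Filter F.
  apply: filter_from_filter.
    exists setT; split=> //; split; first exact: openT.
    by apply/convex_setP.
  move=> b c [[ob /convex_setP cb] bx] [[oc /convex_setP cc] cx].
  exists (b `&` c) => //; split => //; split; first exact: openI.
  apply/convex_setP => y z t t0 t1 [? ?] [? ?].
  by split; [exact: cb|exact: cc].
suff : F --> x by move=> h U /h [b [Bb bx] bU]; exists b.
apply/(@projlim_cvg _ F id x) => n U /= nU.
have [C cC [oC bC]] := @locally_convex K (X n).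
have [V /= [CV Vx] VU] := bC _ _ nU.
exists (p n @^-1` V); last by move=> y /VU.
split => //; split.
  have /continuousP := @projlim_proj_continuous n; apply; exact: oC.
have /convex_setP cV : convex_set V by apply: cC; rewrite inE.
apply/convex_setP => y z t t0 t1 Vy Vz /=.
by rewrite linearD !linearZ; exact: cV.
Qed.

HB.instance Definition _ := PreTopologicalLmod_isTvs.Build K P
  projlim_add_continuous projlim_scale_continuous projlim_locally_convex.
HB.instance Definition _ := PreTopologicalNmodule_isTopologicalNmodule.Build
  P projlim_add_continuous.
HB.instance Definition _ := TopologicalNmodule_isTopologicalLmodule.Build
  K P projlim_scale_continuous.
HB.instance Definition _ := Uniform_isTvs.Build K P projlim_locally_convex.

End ProjectiveLimit.

Section Weights.
Context (R : realType).

(* Only the restriction of the underlying function to [0, +oo[ matters. *)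
Record weight := Weight {
  weight_fun :> R -> R ;
  weight_continuous : {within `[0, +oo[, continuous weight_fun} ;
  weight_gt0 : forall t : R, 0 <= t -> 0 < weight_fun t ;
  weight_noninc : forall s t : R, 0 <= s -> s <= t -> weight_fun t <= weight_fun s ;
  weight_rapid : forall k : nat, t ^+ k * weight_fun t @[t --> +oo] --> 0 }.

Section WeightPower.
Context (v : weight) (c : {posnum R}).

Let vc := fun t => v t `^ c%:num.

Let vc_continuous : {within `[0, +oo[, continuous vc}.
Proof.
have /subspace_continuousP cv := @weight_continuous v.
apply/subspace_continuousP => x x0.
apply: (cvg_comp v (fun a => a `^ c%:num) (cv x x0)).
suff /derivable1_diffP/differentiable_continuous :
  derivable (fun a : R => a `^ c%:num) (v x) 1 by [].
apply: derivable_powR.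
by rewrite in_itv /= andbT weight_gt0//; move: x0; rewrite /= in_itv /= andbT.
Qed.

Let vc_gt0 t : 0 <= t -> 0 < vc t.
Proof. by move=> t0; rewrite powR_gt0// weight_gt0. Qed.

Let vc_noninc s t : 0 <= s -> s <= t -> vc t <= vc s.
Proof.
move=> s0 st; apply: ge0_ler_powR => //.
- by rewrite nnegrE ltW// weight_gt0// (le_trans s0).
- by rewrite nnegrE ltW// weight_gt0.
- exact: weight_noninc.
Qed.

Let vc_rapid (k : nat) : t ^+ k * vc t @[t --> +oo] --> 0.
Proof.
have [m mk] : exists m : nat, k%:R <= m%:R * c%:num.
  exists (Num.truncn (k%:R / c%:num)).+1.
  by rewrite -ler_pdivrMr// ltW// truncnS_gt.
have gtk : (t ^+ m * v t) `^ c%:num @[t --> +oo] --> 0.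
  apply: (cvg_comp (fun t => t ^+ m * v t) (fun a => a `^ c%:num)); last first.
    exact: powR_cvg0.
  move=> U /= nU; have := @weight_rapid v m _ nU; rewrite /= /nbhs /=.
  move: (nbhs_pinfty_gt (num_real (0 : R))).
  apply: filterS2 => t t0 h; apply: h.
  by rewrite mulr_gt0 ?exprn_gt0 ?weight_gt0// ltW.
apply: (@squeeze_cvgr _ _ _ _ (cst 0) (fun t => (t ^+ m * v t) `^ c%:num)) => //.
  near=> t; have t1 : 1 <= t by near: t; apply: nbhs_pinfty_ge; rewrite num_real.
  have t0 : 0 <= t by rewrite (le_trans ler01).
  rewrite mulr_ge0 ?exprn_ge0 ?(ltW (vc_gt0 _))//=.
  rewrite powRM ?exprn_ge0 ?(ltW (weight_gt0 _ _))//.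
  rewrite ler_wpM2r ?(ltW (vc_gt0 _))// -!powR_mulrn// -powRrM.
  exact: ler_powR.
exact: cvg_cst.
Unshelve. all: by end_near. Qed.

Definition weight_pow : weight :=
  Weight vc_continuous vc_gt0 vc_noninc vc_rapid.

End WeightPower.

End Weights.

Section FunctionSpaces.
Context (R : realType).
Local Notation C := R[i].

(* [derivable _ z 1] over the field [C] is complex differentiability at [z]. *)
Definition entire (f : C -> C^o) :=
  forall z : C, derivable (f : C^o -> C^o) z 1.

(* [normc] is the modulus as an element of [R]; [`|_|] is [C]-valued. *)
Definition wnorm (v : R -> R) (f : C -> C^o) : \bar R :=
  ereal_sup (range (fun z : C => (normc (f z) * v (normc z))%:E)).

(* The set of elements of the weighted space; [HinfT] below is the
   corresponding normed space. *)
Definition Hinf (v : R -> R) : set (C -> C^o) :=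
  [set f | entire f /\ (wnorm v f < +oo)%E].

Lemma normc_ge0 (z : C) : 0 <= normc z.
Proof. by case: z => a b /=; exact: sqrtr_ge0. Qed.

Lemma normcE (z : C) : `|z| = (normc z)%:C.
Proof. by []. Qed.

Lemma normc_le (x y : C) : normc (x + y) <= normc x + normc y.
Proof. by have := ler_normD x y; rewrite !normcE -rmorphD lecR. Qed.

Lemma wnorm_le (v : R -> R) f (M : R) :
  (wnorm v f <= M%:E)%E <->
  (forall z, normc (f z) * v (normc z) <= M).
Proof.
split=> [h z|h].
  by rewrite -lee_fin; apply: le_trans h; apply: ereal_sup_ubound; exists z.
by apply: ge_ereal_sup => _ [z _ <-]; rewrite lee_fin.
Qed.

Section WeightedSpace.
Context (v : weight R).

Lemma wnorm_ge0 f : (0 <= wnorm v f)%E.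
Proof.
apply: (@le_trans _ _ (normc (f 0) * v (normc (0 : C)))%:E).
  by rewrite lee_fin mulr_ge0 ?normc_ge0// ltW// weight_gt0// normc_ge0.
by apply: ereal_sup_ubound; exists 0.
Qed.

Lemma wnorm_fineK f : (wnorm v f < +oo)%E -> (fine (wnorm v f))%:E = wnorm v f.
Proof. by move=> h; rewrite fineK// ge0_fin_numE// wnorm_ge0. Qed.

Lemma wnorm_ub f z : (wnorm v f < +oo)%E ->
  normc (f z) * v (normc z) <= fine (wnorm v f).
Proof. by move=> h; move: z; apply/wnorm_le; rewrite wnorm_fineK. Qed.

Lemma wnorm_fine_le f (M : R) : (wnorm v f < +oo)%E ->
  (forall z, normc (f z) * v (normc z) <= M) -> fine (wnorm v f) <= M.
Proof. by move=> h /wnorm_le; rewrite -lee_fin wnorm_fineK. Qed.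

Lemma entire_lin (a : C) (f g : C -> C^o) :
  entire f -> entire g -> entire (a *: f + g).
Proof.
move=> ef eg z.
apply: (@derivableD _ _ _ (a *: (f : C^o -> C^o)) g); last exact: eg.
by apply: derivableZ; exact: ef.
Qed.

Lemma Hinf_submod : submod_closed [in Hinf v].
Proof.
split.
  rewrite inE /=; split; first by move=> z; exact: derivable_cst.
  apply: (@le_lt_trans _ _ 0%:E); last exact: ltry.
  by apply/wnorm_le => z; rewrite normc0 mul0r.
move=> a f g; rewrite !inE /= => -[ef nf] [eg ng]; split.
  exact: entire_lin.
apply: (@le_lt_trans _ _
  (normc a * fine (wnorm v f) + fine (wnorm v g))%:E); last exact: ltry.
apply/wnorm_le => z; rewrite (_ : (a *: f + g) z = a * f z + g z)//.
have v0 : 0 <= v (normc z) by rewrite ltW// weight_gt0// normc_ge0.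
rewrite (le_trans (ler_wpM2r v0 (normc_le _ _)))// mulrDl normcM -mulrA.
by rewrite lerD// ?wnorm_ub// ler_wpM2l ?normc_ge0// wnorm_ub.
Qed.

End WeightedSpace.

Definition fspace_pred (S : set (C -> C^o)) (_ : submod_closed [in S]) :
  {pred C -> C^o} := [in S].

(* A linear subspace [S] of the space of functions [C -> C], as a type. *)
Record fspace (S : set (C -> C^o)) (HS : submod_closed [in S]) := FSpace {
  fspace_fun :> C -> C^o ;
  fspace_in : fspace_fun \in fspace_pred HS }.

Section FSpaceTheory.
Context (S : set (C -> C^o)) (HS : submod_closed [in S]).

HB.instance Definition _ := [isSub for @fspace_fun S HS].
HB.instance Definition _ := [Choice of fspace HS by <:].

HB.instance Definition _ := GRing.isSubmodClosed.Build C _ (fspace_pred HS) HS.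
HB.instance Definition _ := [SubChoice_isSubLmodule of fspace HS by <:].

End FSpaceTheory.
End FunctionSpaces.

Section Inclusions.
Context (R : realType).
Local Notation C := R[i].
Context (S T : set (C -> C^o)) (HS : submod_closed [in S])
  (HT : submod_closed [in T]) (ST : S `<=` T).

Lemma fspace_incl_subproof (f : fspace HS) :
  (f : C -> C^o) \in fspace_pred HT.
Proof. by apply/mem_set/ST/set_mem/fspace_in. Qed.

Definition fspace_incl (f : fspace HS) : fspace HT :=
  FSpace (fspace_incl_subproof f).

Lemma fspace_incl_is_linear : linear fspace_incl.
Proof. by move=> a f g; apply: val_inj. Qed.

HB.instance Definition _ :=
  GRing.isLinear.Build C (fspace HS) (fspace HT) *:%R fspace_incl
    fspace_incl_is_linear.

End Inclusions.
Arguments fspace_incl {R S T} HS HT ST f.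

Section WeightedBanachSpace.
Context (R : realType).
Local Notation C := R[i].

Definition HinfT (v : weight R) : Type := fspace (Hinf_submod v).

HB.instance Definition _ (v : weight R) := GRing.Lmodule.on (HinfT v).

Context (v : weight R).

Definition Hinf_norm (f : HinfT v) : C := (fine (wnorm v f))%:C.

Lemma HinfT_fin (f : HinfT v) : (wnorm v f < +oo)%E.
Proof. by have /set_mem [] := fspace_in f. Qed.

Lemma Hinf_normD (f g : HinfT v) :
  Hinf_norm (f + g) <= Hinf_norm f + Hinf_norm g.
Proof.
rewrite /Hinf_norm -rmorphD lecR; apply: wnorm_fine_le => [|z].
  exact: HinfT_fin.
have v0 : 0 <= v (normc z) by rewrite ltW// weight_gt0// normc_ge0.
rewrite (le_trans (ler_wpM2r v0 (normc_le _ _)))// mulrDl.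
by rewrite lerD// wnorm_ub// HinfT_fin.
Qed.

Let Hinf_normZ_le (a : C) (f : HinfT v) :
  fine (wnorm v (a *: f)) <= normc a * fine (wnorm v f).
Proof.
apply: wnorm_fine_le => [|z]; first exact: HinfT_fin.
rewrite (_ : (a *: f) z = a * f z)// normcM -mulrA.
by rewrite ler_wpM2l ?normc_ge0// wnorm_ub// HinfT_fin.
Qed.

Lemma Hinf_normZ (a : C) (f : HinfT v) :
  Hinf_norm (a *: f) = `|a| * Hinf_norm f.
Proof.
rewrite /Hinf_norm normcE -rmorphM; congr (_%:C).
apply/eqP; rewrite eq_le Hinf_normZ_le /=.
have [->|a0] := eqVneq a 0.
  by rewrite normc0 mul0r fine_ge0// wnorm_ge0.
have na0 : 0 < normc a.
  by rewrite lt_neqAle normc_ge0 andbT eq_sym; apply: contra a0 => /eqP/eq0_normc->.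
have := Hinf_normZ_le a^-1 (a *: f).
by rewrite scalerA mulVf// scale1r normcV mulrC ler_pdivlMr// mulrC.
Qed.

Lemma Hinf_norm_eq0 (f : HinfT v) : Hinf_norm f = 0 -> f = 0.
Proof.
move=> /complexI f0; apply: val_inj; apply/funext => z /=.
apply: eq0_normc; apply/eqP; rewrite eq_le normc_ge0 andbT.
have vz : 0 < v (normc z) by rewrite weight_gt0// normc_ge0.
by rewrite -(ler_pM2r vz) mul0r -f0 wnorm_ub// HinfT_fin.
Qed.

HB.instance Definition _ := Lmodule_isNormed.Build C (HinfT v)
  Hinf_normD Hinf_normZ Hinf_norm_eq0.

End WeightedBanachSpace.

Section WeightedLimits.
Context (R : realType) (v : weight R).
Local Notation C := R[i].

(* [n : nat] stands for the positive integer [n.+1]. *)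
Definition vlow (n : nat) : weight R := weight_pow v (n.+1%:R)%:pos.

Definition vup (n : nat) : weight R := weight_pow v (n.+1%:R^-1)%:pos.

Definition Hlow : set (C -> C^o) := \bigcup_n Hinf (vlow n).

Definition Hup : set (C -> C^o) := \bigcap_n Hinf (vup n).

Lemma Hup_submod : submod_closed [in Hup].
Proof.
split.
  by rewrite inE => n _; have [+ _] := Hinf_submod (vup n); rewrite inE.
move=> a f g; rewrite !inE => Hf Hg n _.
have [_ /(_ a f g)] := Hinf_submod (vup n); rewrite !inE.
by apply; [exact: Hf|exact: Hg].
Qed.

Lemma Hup_sub n : Hup `<=` Hinf (vup n).
Proof. by move=> f; apply. Qed.

Definition Hup_proj n : {linear fspace Hup_submod -> HinfT (vup n)} :=
  fspace_incl Hup_submod (Hinf_submod (vup n)) (@Hup_sub n).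

Definition HupT : Type := projlim Hup_proj.

HB.instance Definition _ := Tvs.copy HupT (projlim Hup_proj).

Context (v1 : forall t : R, 0 <= t -> v t <= 1).

Lemma Hlow_sub m n : (m <= n)%N -> Hinf (vlow m) `<=` Hinf (vlow n).
Proof.
move=> mn f /= [ef nf]; split=> //; apply: le_lt_trans nf.
apply: ge_ereal_sup => _ [z _ <-].
apply: le_trans; last by apply: ereal_sup_ubound; exists z.
have z0 := normc_ge0 z.
rewrite lee_fin ler_wpM2l ?normc_ge0//=; apply: ger_powR.
  by rewrite weight_gt0//= v1.
by rewrite /= ler_nat ltnS.
Qed.

Lemma Hlow_submod : submod_closed [in Hlow].
Proof.
split.
  by rewrite inE; exists 0%N => //; have [+ _] := Hinf_submod (vlow 0); rewrite inE.
move=> a f g; rewrite !inE => -[m _ Hf] [n _ Hg]; exists (maxn m n) => //.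
have [_ /(_ a f g)] := Hinf_submod (vlow (maxn m n)); rewrite !inE.
apply; first exact: Hlow_sub (leq_maxl m n) _ Hf.
exact: Hlow_sub (leq_maxr m n) _ Hg.
Qed.

Lemma Hlow_sup n : Hinf (vlow n) `<=` Hlow.
Proof. by move=> f Hf; exists n. Qed.

Definition Hlow_incl n : {linear HinfT (vlow n) -> fspace Hlow_submod} :=
  fspace_incl (Hinf_submod (vlow n)) Hlow_submod (@Hlow_sup n).

Definition HlowT : Type := indlim Hlow_incl.

HB.instance Definition _ := Tvs.copy HlowT (indlim Hlow_incl).

End WeightedLimits.

(* Main.v *)
Require Import Defs.
From HB Require Import structures.
From mathcomp Require Import all_boot all_order all_algebra.
From mathcomp Require Import all_classical all_reals all_analysis.
From mathcomp Require Import complex.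

Set Implicit Arguments.
Unset Strict Implicit.
Unset Printing Implicit Defensive.

Import Order.TTheory GRing.Theory Num.Theory.
Import numFieldNormedType.Exports.
Import ComplexField.Normc.

Local Open Scope classical_set_scope.
Local Open Scope ring_scope.

(** Everything rests on the submultiplicativity of the weighted norms: if
[w <= u1 * u2], then [|f g|_w <= |f|_u1 |g|_u2], by multiplying the two bounds
at each point. With [w = v^(m+n)], [u1 = v^m] and [u2 = v^n] this shows that the
union of the spaces is closed under products; with [w = v^(1/n)] and
[u1 = u2 = v^(1/(2n))] it shows that the intersection is, and it also gives the
continuity on the projective limit, whose topology is tested on the projections
one at a time.

Continuity on the inductive limit is the real point. For each pair of steps the
product is continuous, but neighbourhoods of 0 in an inductive limit are small
to a different extent on each step, and in general a bilinear map that is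
continuous on every pair of steps is only separately continuous. What saves the
statement is that the steps are normed and form a sequence
([indlim_bilinear_continuous]). Fix an absolutely convex neighbourhood [W] of 0
in the target. On a normed step the unit ball is bounded, so it is sent into [W]
when paired with all small enough elements of another step
([near0_unit_ball]). For each [n] only finitely many steps [m <= n] come before
it, so there is a neighbourhood [N n] of 0 in the [n]-th step, inside its unit
ball, that pairs into [W] with the unit balls of all of them. Define [M m]
likewise on the left. Since any two indices are comparable, [M m] and [N n] pair
into [W] for all [m] and [n]. It remains to find neighbourhoods [A] and [B] of 0
in the limits that contain these sets and still pair into [W]; two successive
polars with respect to [W] provide them. *)

(** * Bilinear maps on topological vector spaces *)

Section BilinearContinuity.
Context (K : numFieldType).

Lemma near0_scale (E : tvsType K) (x : E) (U : set E) :
  nbhs (0 : E) U -> exists2 a : K, a != 0 & U (a *: x).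
Proof.
move=> nU; have := @scale_continuous K E (0, x).
rewrite /continuous_at /= scale0r.
move=> /(_ U nU) [[A B] /= [/nbhs_ballP[d /= d0 dA] nB] AB]; exists (d / 2).
  by rewrite mulf_neq0 ?invr_eq0 ?pnatr_eq0// gt_eqF.
apply: (AB (d / 2, x)); split => /=; last exact: nbhs_singleton nB.
apply: dA; rewrite -ball_normE /= sub0r normrN gtr0_norm ?divr_gt0//.
by rewrite ltr_pdivrMr// ltr_pMr// ltr1n.
Qed.

Lemma near0_norm_lt (V : normedModType K) (r : K) :
  0 < r -> \forall x \near (0 : V), `|x| < r.
Proof.
move=> r0; apply/nbhs_ballP; exists r => //= x.
by rewrite -ball_normE /= sub0r normrN.
Qed.

(** In the expansion of [b] around [(x, y)] the mixed term [b x (p.2 - y)]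
tends to 0 because a nonzero scalar [a] brings [x] close to 0, and [b x z] is
[b (a *: x) (a^-1 *: z)]. *)
Lemma bilinear_continuous (E F G : tvsType K) (b : {bilinear E -> F -> G}) :
  (fun p : E * F => b p.1 p.2) @ ((0, 0) : E * F) --> (0 : G) ->
  continuous (fun p : E * F => b p.1 p.2).
Proof.
move=> b0.
have bx x : b x y @[y --> (0 : F)] --> (0 : G).
  move=> U /b0 [[A B] /= [nA nB] AB].
  have [a a0 Aax] := near0_scale x nA.
  have := nbhs0Z a0 nB; apply: filterS => _ [y By <-] /=.
  by rewrite linearZr_LR -linearZl_LR; exact: (AB (a *: x, y)).
have yb y : b x y @[x --> (0 : E)] --> (0 : G).
  move=> U /b0 [[A B] /= [nA nB] AB].
  have [a a0 Bay] := near0_scale y nB.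
  have := nbhs0Z a0 nA; apply: filterS => _ [x Ax <-] /=.
  by rewrite linearZl_LR -linearZr_LR; exact: (AB (x, a *: y)).
have subcvg (H : tvsType K) (x : H) : z - x @[z --> x] --> (0 : H).
  rewrite -(subrr x).
  apply: (cvg_comp2 (h := +%R) _ _ (@add_continuous H (x, - x))).
  - exact: cvg_id.
  - exact: cvg_cst.
move=> [x y].
have bE : (fun p : E * F => b p.1 p.2) = (fun p =>
    b x y + (b x (p.2 - y) + (b (p.1 - x) y + b (p.1 - x) (p.2 - y)))).
  apply/funext => p /=; rewrite addrA -linearDr/= [y + _]addrC subrK.
  by rewrite -linearDr/= [y + _]addrC subrK -linearDl/= [x + _]addrC subrK.
rewrite /continuous_at {1}bE /=.
have addcvg (f g : E * F -> G) c d :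
    f @ ((x, y) : E * F) --> c -> g @ ((x, y) : E * F) --> d ->
    f p + g p @[p --> ((x, y) : E * F)] --> c + d.
  move=> fc gd.
  exact: (cvg_comp2 (h := +%R) fc gd (@add_continuous G (c, d))).
have f1 : p.1 - x @[p --> ((x, y) : E * F)] --> (0 : E).
  by apply: (cvg_comp fst (fun z => z - x)); [exact: cvg_fst|exact: subcvg].
have f2 : p.2 - y @[p --> ((x, y) : E * F)] --> (0 : F).
  by apply: (cvg_comp snd (fun z => z - y)); [exact: cvg_snd|exact: subcvg].
rewrite -[X in _ --> X]addr0 -[X in _ --> _ + X]addr0.
rewrite -[X in _ --> _ + (_ + X)]addr0.
apply: (addcvg); first exact: cvg_cst.
apply: (addcvg); first exact: (cvg_comp _ (b x) f2 (bx x)).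
apply: (addcvg); first exact: (cvg_comp _ (b^~ y) f1 (yb y)).
exact: (cvg_comp2 (h := b) f1 f2 b0).
Qed.

(** Boundedness of the unit ball, phrased for a relation [P] that only allows
scalars to move from the first variable to the second: this covers both
variables of a bilinear map with a single proof. *)
Lemma near0_unit_ball (X : normedModType K) (Y : tvsType K)
    (P : X -> Y -> Prop) :
  (forall a x y, P (a *: x) y -> P x (a *: y)) ->
  (\forall p \near ((0, 0) : X * Y), P p.1 p.2) ->
  \forall y \near (0 : Y), forall x : X, `|x| < 1 -> P x y.
Proof.
move=> PZ [[A B] /= [/nbhs_ballP[d /= d0 dA] nB] AB].
have := nbhs0Z (lt0r_neq0 d0) nB; apply: filterS => _ [y By <-] x x1.
apply: PZ; apply: (AB (d *: x, y)); split => //; apply: dA.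
by rewrite -ball_normE /= sub0r normrN normrZ gtr0_norm// gtr_pMr.
Qed.

(** * Bilinear maps on inductive limits of normed spaces *)

(** When the steps cover the limit, absorption is inherited from the steps. *)
Lemma indlim_base_cover (E : lmodType K) (X : nat -> tvsType K)
    (i : forall n, {linear X n -> E}) (W : set E) :
  (forall x, exists n z, x = i n z) -> convex_set W -> balanced W ->
  (forall n, nbhs (0 : X n) (i n @^-1` W)) -> indlim_base i W.
Proof.
move=> iS cW bW nW; split=> // x; have [n [z ->]] := iS x.
have /= [a a0 Waz] := near0_scale z (nW n).
apply/nbhs_ballP; exists `|a| => /=; first by rewrite normr_gt0.
move=> c; rewrite -ball_normE /= sub0r normrN => ca.
rewrite -(divfK a0 c) -scalerA -[a *: _]linearZ; apply: bW; last exact: Waz.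
by rewrite normrM normfV ler_pdivrMr ?normr_gt0// mul1r ltW.
Qed.

(** Continuity on each pair of steps is enough because the steps are normed,
which gives them bounded neighbourhoods of 0, and because each index in [nat]
has finitely many predecessors, so that only finitely many conditions are
imposed on each step. *)
Lemma indlim_bilinear_continuous (E F G : lmodType K)
    (X Y : nat -> normedModType K) (Z : nat -> tvsType K)
    (i : forall n, {linear X n -> E}) (j : forall n, {linear Y n -> F})
    (k : forall n, {linear Z n -> G})
    (b : {bilinear indlim i -> indlim j -> indlim k}) :
  (forall x, exists n z, x = i n z) -> (forall y, exists n z, y = j n z) ->
  (forall m n, (fun p : X m * Y n => b (i m p.1) (j n p.2)) @
     ((0, 0) : X m * Y n) --> (0 : indlim k)) ->
  continuous (fun p : indlim i * indlim j => b p.1 p.2).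
Proof.
move=> iS jS bc; apply: bilinear_continuous => U /= [W bW WU].
have {}WU f : W f -> U f by move=> /WU; rewrite add0r.
have [/convex_setP cW blW _ _] := bW.
have nW : nbhs (0 : indlim k) W by exists W => // y; rewrite add0r.
pose M m := [set x : X m | `|x| < 1 /\
  forall n : 'I_m.+1, forall y : Y n, `|y| < 1 -> W (b (i m x) (j n y))].
pose N n := [set y : Y n | `|y| < 1 /\
  forall m : 'I_n.+1, forall x : X m, `|x| < 1 -> W (b (i m x) (j n y))].
have nM m : nbhs (0 : X m) (M m).
  apply: filterI; first exact: near0_norm_lt ltr01.
  apply: filter_forall => n.
  apply: (near0_unit_ball (P := fun y x => W (b (i m x) (j n y)))).
    by move=> a y x; rewrite (linearZ_LR (i m)) (linearZ_LR (j n))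
      linearZr_LR linearZl_LR.
  have [[A B] /= [nA nB] AB] := bc m n _ nW.
  by exists (B, A) => //= -[y x] /= [By Ax]; exact: (AB (x, y)).
have nN n : nbhs (0 : Y n) (N n).
  apply: filterI; first exact: near0_norm_lt ltr01.
  apply: filter_forall => m.
  apply: (near0_unit_ball (P := fun x y => W (b (i m x) (j n y)))).
    by move=> a x y; rewrite (linearZ_LR (i m)) (linearZ_LR (j n))
      linearZr_LR linearZl_LR.
  exact: bc m n _ nW.
have MN m n x y : M m x -> N n y -> W (b (i m x) (j n y)).
  move=> [x1 Mx] [y1 Ny]; have [mn|nm] := leqP m n.
    by have lt : (m < n.+1)%N by []; exact: (Ny (Ordinal lt)).
  have lt : (n < m.+1)%N by rewrite ltnS ltnW.
  exact: (Mx (Ordinal lt)).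
(* [A] and [B] are polars: they inherit convexity and balancedness from [W], so
   no convex hull of the sets [M m] and [N n] has to be formed. *)
pose A := [set f : E | forall n y, N n y -> W (b f (j n y))].
pose B := [set g : F | forall f, A f -> W (b f g)].
have bA : indlim_base i A.
  apply: indlim_base_cover => //.
  - apply/convex_setP => f g t t0 t1 Af Ag n y Ny.
    by rewrite linearDl !linearZl_LR; apply: cW; [..|exact: Af|exact: Ag].
  - move=> a f a1 Af n y Ny.
    by rewrite linearZl_LR; apply: blW => //; exact: Af.
  - move=> m; have := nM m; apply: filterS => x Mx n y; exact: MN.
have bB : indlim_base j B.
  apply: indlim_base_cover => //.
  - apply/convex_setP => f g t t0 t1 Bf Bg h Ah.
    by rewrite linearDr !linearZr_LR; apply: cW; [..|exact: Bf|exact: Bg].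
  - move=> a f a1 Bf h Ah.
    by rewrite linearZr_LR; apply: blW => //; exact: Bf.
  - move=> n; have := nN n; apply: filterS => y Ny f; exact.
exists (A, B).
  by split; [exists A => // f|exists B => // f]; rewrite add0r.
by move=> [f g] /= [Af Bg]; apply: WU; exact: Bg.
Qed.

End BilinearContinuity.

(** * Products in the weighted spaces *)

Section FSpaceProduct.
Context (R : realType).
Local Notation C := R[i].
Context (S T U : set (C -> C^o)) (HS : submod_closed [in S])
  (HT : submod_closed [in T]) (HU : submod_closed [in U]).
Context (STU : forall f g, S f -> T g -> U (f \* g)).

Lemma fspace_mul_subproof (f : fspace HS) (g : fspace HT) :
  (f \* g : C -> C^o) \in fspace_pred HU.
Proof. by apply/mem_set/STU; apply/set_mem/fspace_in. Qed.

Definition fspace_mul (f : fspace HS) (g : fspace HT) : fspace HU :=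
  FSpace (fspace_mul_subproof f g).

Lemma fspace_mul_bilinear : bilinear_for *:%R *:%R fspace_mul.
Proof.
split=> h a f g; apply: val_inj; apply/funext => z /=.
  by rewrite -[LHS]/((a * f z + g z) * h z) mulrDl -mulrA.
by rewrite -[LHS]/(h z * (a * f z + g z)) mulrDr mulrCA.
Qed.

HB.instance Definition _ :=
  bilinear_isBilinear.Build C (fspace HS) (fspace HT) (fspace HU)
    *:%R *:%R fspace_mul fspace_mul_bilinear.

End FSpaceProduct.
Arguments fspace_mul {R S T U} HS HT HU STU f g.

Section HinfProduct.
Context (R : realType).
Local Notation C := R[i].

Lemma entireM (f g : C -> C^o) : entire f -> entire g -> entire (f \* g).
Proof.
move=> ef eg z.
exact: (@derivableM C C^o (f : C^o -> C^o) g z 1 (ef z) (eg z)).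
Qed.

Lemma wnormM_le (u v w : weight R) (f g : C -> C^o) :
  (forall t, 0 <= t -> w t <= u t * v t) ->
  (wnorm u f < +oo)%E -> (wnorm v g < +oo)%E ->
  (wnorm w (f \* g)%R <= (fine (wnorm u f) * fine (wnorm v g))%:E)%E.
Proof.
move=> wuv uf vg; apply/wnorm_le => z.
have wz0 (s : weight R) : 0 <= s (normc z).
  by rewrite ltW// weight_gt0// normc_ge0.
rewrite normcM (le_trans (ler_wpM2l _ (wuv _ (normc_ge0 z))))
  ?mulr_ge0 ?normc_ge0//.
by rewrite mulrACA ler_pM ?wnorm_ub// mulr_ge0 ?normc_ge0.
Qed.

Lemma HinfM (u v w : weight R) :
  (forall t, 0 <= t -> w t <= u t * v t) ->
  forall f g, Hinf u f -> Hinf v g -> Hinf w (f \* g).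
Proof.
move=> wuv f g [ef uf] [eg vg]; split; first exact: entireM.
exact: le_lt_trans (wnormM_le wuv uf vg) (ltry _).
Qed.

Context (u v w : weight R) (wuv : forall t, 0 <= t -> w t <= u t * v t).

Definition Hinf_mul : {bilinear HinfT u -> HinfT v -> HinfT w} :=
  fspace_mul (Hinf_submod u) (Hinf_submod v) (Hinf_submod w) (HinfM wuv).

Lemma Hinf_mul_continuous :
  continuous (fun p : HinfT u * HinfT v => Hinf_mul p.1 p.2).
Proof.
apply: bilinear_continuous; apply/cvgr0Pnorm_lt => e e0.
exists ([set f | `|f| < 1], [set g | `|g| < e]).
  split; first exact: (@near0_norm_lt C (HinfT u) 1 ltr01).
  exact: (@near0_norm_lt C (HinfT v) e e0).
move=> [f g] /= [f1 ge].
apply: (@le_lt_trans _ _ (`|f| * `|g|)); last first.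
  by rewrite (le_lt_trans (ler_piMl _ (ltW f1))).
rewrite -[X in X <= _]/(Hinf_norm _) -[X in _ <= X]/(Hinf_norm f * Hinf_norm g).
rewrite -rmorphM lecR -lee_fin wnorm_fineK ?HinfT_fin//.
by apply: wnormM_le; rewrite ?HinfT_fin.
Qed.

End HinfProduct.

(** An index [n] stands for the exponent [n.+1], so the sum of the exponents
[m.+1] and [n.+1] has index [(m + n).+1]. *)
Lemma vlowM (R : realType) (v : weight R) m n t : 0 <= t ->
  vlow v (m + n).+1 t = vlow v m t * vlow v n t.
Proof.
move=> t0 /=.
rewrite -powRD; last by apply/implyP => _; rewrite gt_eqF// weight_gt0.
by rewrite -natrD addSn addnS.
Qed.

(** An index [n] stands for the exponent [1 / n.+1], and [n.*2.+1] for half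
of it. *)
Lemma vupM (R : realType) (v : weight R) n t : 0 <= t ->
  vup v n t = vup v n.*2.+1 t * vup v n.*2.+1 t.
Proof.
move=> t0 /=.
rewrite -powRD; last by apply/implyP => _; rewrite gt_eqF// weight_gt0.
congr (_ `^ _); rewrite -doubleS -muln2 natrM invfM -mulrDr.
by rewrite -[2^-1]div1r -splitr mulr1.
Qed.

(** * Products in the limits *)

Section Products.
Context (R : realType) (v : weight R).

Lemma HlowM f g : Hlow v f -> Hlow v g -> Hlow v (f \* g).
Proof.
move=> [m _ Hf] [n _ Hg]; exists (m + n).+1 => //.
by apply: HinfM Hf Hg => t t0; rewrite vlowM.
Qed.

Lemma HupM f g : Hup v f -> Hup v g -> Hup v (f \* g).
Proof.
move=> Hf Hg n _; apply: HinfM (Hf n.*2.+1 I) (Hg n.*2.+1 I) => t t0.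
by rewrite vupM.
Qed.

Definition Hup_mul : {bilinear HupT v -> HupT v -> HupT v} :=
  fspace_mul (Hup_submod v) (Hup_submod v) (Hup_submod v) HupM.

Lemma Hup_mul_continuous :
  continuous (fun p : HupT v * HupT v => Hup_mul p.1 p.2).
Proof.
move=> x; apply/projlim_cvg => n.
pose k := n.*2.+1.
have vk t : 0 <= t -> vup v n t <= vup v k t * vup v k t.
  by move=> t0; rewrite -vupM.
have projM f g : Hup_proj v n (Hup_mul f g) =
  Hinf_mul vk (Hup_proj v k f) (Hup_proj v k g) by exact: val_inj.
rewrite projM; under eq_fun do rewrite projM.
have f1 : Hup_proj v k p.1 @[p --> x] --> Hup_proj v k x.1.
  apply: (cvg_comp fst (Hup_proj v k)); first exact: cvg_fst.
  exact: (@projlim_proj_continuous _ _ _ (Hup_proj v) k).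
have f2 : Hup_proj v k p.2 @[p --> x] --> Hup_proj v k x.2.
  apply: (cvg_comp snd (Hup_proj v k)); first exact: cvg_snd.
  exact: (@projlim_proj_continuous _ _ _ (Hup_proj v) k).
exact: (cvg_comp2 (h := fun f g => Hinf_mul vk f g) f1 f2
  (@Hinf_mul_continuous R _ _ _ vk (Hup_proj v k x.1, Hup_proj v k x.2))).
Qed.

Context (v1 : forall t : R, 0 <= t -> v t <= 1).

Definition Hlow_mul : {bilinear HlowT v1 -> HlowT v1 -> HlowT v1} :=
  fspace_mul (Hlow_submod v1) (Hlow_submod v1) (Hlow_submod v1) HlowM.

Lemma Hlow_incl_surj (f : HlowT v1) : exists n g, f = Hlow_incl v1 n g.
Proof.
have /set_mem[n _ fn] := fspace_in f.
exists n, (FSpace (mem_set fn : _ \in fspace_pred (Hinf_submod (vlow v n)))).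
exact: val_inj.
Qed.

Lemma Hlow_mul_continuous :
  continuous (fun p : HlowT v1 * HlowT v1 => Hlow_mul p.1 p.2).
Proof.
apply: (indlim_bilinear_continuous (X := fun n => HinfT (vlow v n))
  (Y := fun n => HinfT (vlow v n))) Hlow_incl_surj Hlow_incl_surj _ => m n.
have vmn t : 0 <= t -> vlow v (m + n).+1 t <= vlow v m t * vlow v n t.
  by move=> t0; rewrite vlowM.
have inclM f g : Hlow_mul (Hlow_incl v1 m f) (Hlow_incl v1 n g) =
  Hlow_incl v1 (m + n).+1 (Hinf_mul vmn f g) by exact: val_inj.
have mul0 := @Hinf_mul_continuous R _ _ _ vmn (0, 0).
rewrite /continuous_at linear0r in mul0.
have incl0 := @indlim_incl_continuous _ _ _ (Hlow_incl v1) (m + n).+1 0.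
rewrite /continuous_at linear0 in incl0.
have lim := cvg_comp _ _ mul0 incl0.
move=> U /lim [[A B] nAB AB]; exists (A, B) => // p /AB /=.
by rewrite inclM.
Qed.

End Products.

Theorem proposition4p1 (R : realType) (v : weight R)
    (v1 : forall t : R, 0 <= t -> v t <= 1) :
  [/\ forall f g, Hlow v f -> Hlow v g -> Hlow v (f \* g),
      forall f g, Hup v f -> Hup v g -> Hup v (f \* g),
      exists m : {bilinear HlowT v1 -> HlowT v1 -> HlowT v1},
        (forall f g z, m f g z = f z * g z) /\
        continuous (fun p : HlowT v1 * HlowT v1 => m p.1 p.2)
    & exists m : {bilinear HupT v -> HupT v -> HupT v},
        (forall f g z, m f g z = f z * g z) /\
        continuous (fun p : HupT v * HupT v => m p.1 p.2)].
Proof.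
split.
- exact: HlowM.
- exact: HupM.
- by exists (Hlow_mul v1); split; last exact: Hlow_mul_continuous.
- by exists (Hup_mul v); split; last exact: Hup_mul_continuous.
Qed.
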